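(* Let $g$ be a positive real-valued function on the positive integers such that $g(k) \to 0$ as $k \to \infty$ (the convergence may be arbitrarily slow), and let $N^{-}(k) = 2^{k/2} k^{1/2} g(k)$. Then the probability that a $2$-coloring of $\{1,2,\ldots,N^{-}(k)\}$, chosen uniformly at random, contains a monochromatic $k$-term arithmetic progression approaches $0$ as $k \to \infty$.
   Context: For a real number $x > 0$, $\{1,2,\ldots,x\}$ denotes the set of all integers $m$ with $1 \le m \le x$ (empty if $x<1$). A $2$-coloring of a finite set $X$ is a function from $X$ to a fixed two-element set of colors; ''chosen uniformly at random'' means each of the $2^{|X|}$ colorings is equally likely. A $k$-term arithmetic progression ($k$-AP) in $X$ is a set $\{a, a+d, \ldots, a+(k-1)d\} \subseteq X$ with $a$ an integer and $d$ a positive integer (the common difference). It is monochromatic under a coloring if all its elements receive the same color. *)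

(* Defs.v *)
From mathcomp Require Import all_boot all_order all_algebra.
From mathcomp Require Import finmap.
From mathcomp Require Import all_classical all_reals all_analysis.

Set Implicit Arguments.
Unset Strict Implicit.
Unset Printing Implicit Defensive.

Import Order.TTheory GRing.Theory Num.Theory.
Import numFieldNormedType.Exports.
Local Open Scope ring_scope.

Definition int_upto (R : realType) (x : R) : {fset int} :=
  [fset (n%:Z) | n in iota 1 (Num.truncn x)]%fset.

Lemma in_int_upto (R : realType) (x : R) (m : int) :
  (m \in int_upto x) = (1 <= m) && (m%:~R <= x).
Proof.
have nE (n : nat) : (n \in iota 1 (Num.truncn x)) = (0 < n)%N && (n%:R <= x).
  rewrite mem_iota add1n ltnS; case: n => [|n] //=.
  by rewrite truncn_gt_nat.
apply/imfsetP/andP => /= [[n + ->]|[m1 mx]].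
  by rewrite nE => /andP[n0 nx].
case: m m1 mx => // n n1 nx; exists n => //.
by rewrite nE; apply/andP.
Qed.

Definition arith_prog (k : nat) (a d : int) : {fset int} :=
  [fset (a + d *+ j)%R | j in iota 0 k]%fset.

(* The two colors are the booleans; {ffun X -> bool} is the finite type of all
   2-colorings of X. *)
Definition monochromatic (X : {fset int}) (c : {ffun X -> bool})
    (A : {fset int}) : Prop :=
  exists b : bool, forall x : X, val x \in A -> c x = b.

Definition contains_mono_AP (k : nat) (X : {fset int}) (c : {ffun X -> bool})
    : Prop :=
  exists a d : int,
    [/\ 0 < d, (arith_prog k a d `<=` X)%fset & monochromatic c (arith_prog k a d)].

(* Probability of E under the uniform distribution on the nonempty type T. *)
Definition uniform_prob_of (R : realType) (T : finType) (E : T -> Prop) : R :=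
  #|[set t : T | `[< E t >]]%SET|%:R / #|T|%:R.

Definition prob_mono_AP (R : realType) (k : nat) (X : {fset int}) : R :=
  uniform_prob_of R (@contains_mono_AP k X).

Definition Nminus (R : realType) (g : nat -> R) (k : nat) : R :=
  2 `^ (k%:R / 2) * k%:R `^ (1 / 2) * g k.

(* Main.v *)
(* A union bound. In {1, ..., n} a k-AP has first term at most n and difference
   at most n / (k - 1), and each is monochromatic with probability 2^(1-k), so
   the probability is at most 2 n^2 / ((k - 1) 2^k) <= 4 n^2 / (k 2^k). For
   n <= 2^(k/2) k^(1/2) g(k) this is at most 4 g(k)^2. *)
Require Import Defs.
From mathcomp Require Import all_boot all_order all_algebra.
From mathcomp Require Import finmap.
From mathcomp Require Import all_classical all_reals all_analysis.
From mathcomp Require Import zify ring lra.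

Import Order.TTheory GRing.Theory Num.Theory.
Import numFieldNormedType.Exports.
Local Open Scope classical_set_scope.
Local Open Scope ring_scope.

(** A point of [B] has one admissible color and any other point has two, which gives
    [2 ^ (#|T| - #|B|)] colorings; the product form avoids truncated subtraction. *)
Lemma card_colorings_eq_on (T : finType) (B : {set T}) (b : bool) :
  (#|[set c : {ffun T -> bool} | [forall x in B, c x == b]]%SET| * 2 ^ #|B|
   = 2 ^ #|T|)%N.
Proof.
pose F (x : T) := if x \in B then pred1 b else predT.
have -> : #|[set c : {ffun T -> bool} | [forall x in B, c x == b]]%SET|
          = #|family F|.
  apply: eq_card => c; rewrite inE; apply/forall_inP/familyP => h x.
    by rewrite /F; case: ifP => [/h|//]; rewrite inE.
  by move=> xB; have := h x; rewrite /F xB inE.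
rewrite card_family boot.bigop.foldrE big_map big_enum /=.
rewrite (eq_bigr (fun x => if x \notin B then 2 else 1)%N); last first.
  by move=> x _; rewrite /F; case: ifP => _ /=; rewrite ?card1 ?card_bool.
rewrite -big_mkcond /= prod_nat_const -expnD addnC.
by rewrite (_ : #|[pred x | x \notin B]| = #|[predC B]|) ?cardC //.
Qed.

Lemma card_arith_prog (k : nat) (a d : int) : 0 < d ->
  #|` arith_prog k a d| = k.
Proof.
move=> d0; rewrite card_imfset /= ?undup_id ?iota_uniq ?size_iota // => i j /addrI /eqP.
by rewrite eq_le !ler_pMn2l // -eqn_leq => /eqP.
Qed.

(** Split by the common color: inclusion in [X] leaves all [k] terms inside the domain, so each of
    the two colors accounts for [2 ^ (#|X| - k)] colorings. *)
Lemma card_colorings_mono_arith_prog (k : nat) (X : {fset int}) (a d : int) :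
  0 < d -> (arith_prog k a d `<=` X)%fset ->
  (#|[set c : {ffun X -> bool} | `[< monochromatic c (arith_prog k a d) >]]%SET|
     * 2 ^ k <= 2 * 2 ^ #|{: X}|)%N.
Proof.
move=> d0 sX; set P := arith_prog k a d.
pose S (b : bool) :=
  [set c : {ffun X -> bool} | [forall x in fsub X P, c x == b]]%SET.
have sub : [set c : {ffun X -> bool} | `[< monochromatic c P >]]%SET
           \subset S true :|: S false.
  apply/fintype.subsetP => c; rewrite inE => /asboolP[b mono].
  have cS : c \in S b.
    by rewrite inE; apply/forall_inP => x; rewrite in_fsub => /mono ->.
  by rewrite finset.in_setU; case: b cS {mono} => ->; rewrite ?orbT.
have cardS b : (#|S b| * 2 ^ k = 2 ^ #|{: X}|)%N.
  by rewrite -(card_colorings_eq_on _ (fsub X P) b) card_fsub // card_arith_prog.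
apply: leq_trans (leq_mul (subset_leq_card sub) (leqnn _)) _.
apply: leq_trans (leq_mul (leq_card_setU _ _) (leqnn _)) _.
by rewrite mulnDl !cardS mul2n addnn.
Qed.

Lemma card_mono_AP (R : realType) (k : nat) (x : R) : (1 < k)%N ->
  (#|[set c : {ffun int_upto x -> bool} | `[< contains_mono_AP k c >]]%SET| * 2 ^ k
   <= Num.truncn x * (Num.truncn x %/ k.-1) * (2 * 2 ^ #|{: int_upto x}|))%N.
Proof.
set X := int_upto x; set n := Num.truncn x => k1.
have XP (m : int) : (m \in X) = (1 <= m) && (m <= n%:Z).
  rewrite in_int_upto; case: m => [[|m]|] //; congr andb.
  by rewrite lez_nat [RHS]truncn_gt_nat.
(* Ordinals start at 0, so both components are shifted by one to give a first term and a difference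
   that are at least 1. *)
pose A (p : 'I_n * 'I_(n %/ k.-1)) := arith_prog k (p.1.+1%:Z) (p.2.+1%:Z).
(* Some pairs describe progressions that leave [X]; the second conjunct makes [M p] empty for
   them. *)
pose M p := [set c : {ffun X -> bool} |
  `[< monochromatic c (A p) >] && (A p `<=` X)%fset]%SET.
have sub : [set c : {ffun X -> bool} | `[< contains_mono_AP k c >]]%SET
           \subset (\bigcup_p M p)%SET.
  apply/fintype.subsetP => c; rewrite inE => /asboolP[a [d [d0 sX mono]]].
  have apX j : (j < k)%N -> a + d *+ j \in X.
    move=> jk; apply: (fsubsetP sX); apply/imfsetP; exists j => //=.
    by rewrite mem_iota.
  (* Only the two end terms matter: the first bounds [a], and the last, [a + (k - 1) d <= n], bounds
     [d]. *)
  have := apX 0%N (ltnW k1); rewrite mulr0n addr0 XP => /andP[a1 an].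
  have := apX k.-1; rewrite XP ltn_predL ltnW // => /(_ isT) /andP[_ adn].
  case: a a1 an adn sX mono {apX} => [[|a]|] // _ an adn sX mono.
  case: d d0 adn sX mono => [[|d]|] // _ adn sX mono.
  have an' : (a < n)%N by [].
  have dn : (d < n %/ k.-1)%N.
    rewrite leq_divRL; last by lia.
    move: adn; rewrite pmulrn mulrzz -PoszM -PoszD lez_nat.
    by apply: leq_trans; rewrite leq_addl.
  apply/bigcupP; exists (Ordinal an', Ordinal dn) => //.
  by rewrite inE sX andbT; apply/asboolP.
apply: leq_trans (leq_mul (subset_leq_card sub) (leqnn _)) _.
have -> : (n * (n %/ k.-1))%N = #|{: 'I_n * 'I_(n %/ k.-1)}|.
  by rewrite card_prod !card_ord.
(* The union bound, followed by a uniform estimate of each summand. *)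
apply: (@leq_trans ((\sum_p #|M p|) * 2 ^ k)%N).
  rewrite leq_mul2r; apply/orP; right.
  elim/big_rec2: _ => [|p u B _ IH]; first by rewrite cards0.
  by apply: leq_trans (leq_card_setU _ _) _; rewrite leq_add2l.
rewrite -sum_nat_const big_distrl leq_sum // => p _.
have [sX|nsX] := boolP (A p `<=` X)%fset; last first.
  rewrite (_ : M p = finset.set0) ?cards0 //.
  by apply/setP => c; rewrite !inE (negPf nsX) andbF.
apply: leq_trans (card_colorings_mono_arith_prog _ _ _ _ _ sX) => //.
rewrite leq_mul2r; apply/orP; right; apply: subset_leq_card.
by apply/fintype.subsetP => c /setIdP[mono _]; rewrite inE.
Qed.

(** Divide the count by the number of colorings. The constant 4 is one factor 2 for the colors times
    another for replacing [k - 1] by [k]. *)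
Lemma prob_mono_AP_le (R : realType) (k : nat) (x : R) : (1 < k)%N -> 0 <= x ->
  prob_mono_AP R k (int_upto x) <= 4 * (x ^+ 2 / (2 ^+ k * k%:R)).
Proof.
move=> k1 x0; rewrite /prob_mono_AP /uniform_prob_of.
rewrite card_ffun card_bool.
have := card_mono_AP R k x k1.
set X := int_upto x; set n := Num.truncn x; set B := #|_| => le_card.
have kR : 2 <= k%:R :> R by rewrite ler_nat.
have nx : n%:R <= x by rewrite truncn_le.
have p2 m : 0 < 2 ^+ m :> R by rewrite exprn_gt0.
(* Since [k >= 2], [k <= 2 (k - 1)], so [n / (k - 1) <= 2 n / k]. *)
have le_div : (n %/ k.-1)%:R * k%:R <= 2 * x.
  apply: (@le_trans _ _ (2 * n%:R)); last by rewrite ler_pM2l.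
  rewrite -!natrM ler_nat.
  have := leq_divM n k.-1; nia.
move: B #|{: X}| le_card => {X} b t le_card.
have {}le_card : b%:R * 2 ^+ k <= n%:R * (n %/ k.-1)%:R * (2 * 2 ^+ t) :> R.
  by rewrite -!natrX -!natrM ler_nat.
have kpos : 0 < 2 ^+ k * k%:R :> R by rewrite mulr_gt0 //; lra.
rewrite natrX ler_pdivrMr // [leRHS](_ : _ = 4 * x ^+ 2 * 2 ^+ t / (2 ^+ k * k%:R));
  last by ring.
rewrite ler_pdivlMr // mulrA.
apply: le_trans (ler_wpM2r (ler0n R k) le_card) _.
have -> : n%:R * (n %/ k.-1)%:R * (2 * 2 ^+ t) * k%:R
  = (n%:R * ((n %/ k.-1)%:R * k%:R)) * (2 * 2 ^+ t) :> R by ring.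
have -> : 4 * x ^+ 2 * 2 ^+ t = (x * (2 * x)) * (2 * 2 ^+ t) :> R by ring.
by rewrite ler_pM2r ?mulr_gt0 // ler_pM // mulr_ge0.
Qed.

(** Squaring clears the half exponents and produces exactly the denominator [2 ^+ k * k%:R] of the
    probability bound. *)
Lemma Nminus_sqr (R : realType) (g : nat -> R) (k : nat) :
  Nminus g k ^+ 2 = 2 ^+ k * k%:R * g k ^+ 2.
Proof.
have powR_sqr (a b : R) : (a `^ b) ^+ 2 = a `^ (b * 2).
  by rewrite -powR_mulrn ?powR_ge0 // powRrM.
by rewrite /Nminus !exprMn !powR_sqr !divfK // powR_mulrn // powRr1.
Qed.

Theorem theorem2 (R : realType) (g : nat -> R)
    (g_gt0 : forall k : nat, (0 < k)%N -> 0 < g k)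
    (g_cvg0 : g k @[k --> \oo] --> (0 : R)) :
  prob_mono_AP R k (int_upto (Nminus g k)) @[k --> \oo] --> (0 : R).
Proof.
have bound_cvg0 : 4 * (g k * g k) @[k --> \oo] --> (0 : R).
  rewrite -[X in _ --> X](_ : 4 * (0 * 0) = 0 :> R); last by rewrite !mulr0.
  exact: cvgM (cvg_cst _) (cvgM g_cvg0 g_cvg0).
(* The probability is squeezed between 0 and [4 * (g k * g k)], for all [k > 1]. *)
apply: (squeeze_cvgr _ (cvg_cst _) bound_cvg0).
near=> k.
have k1 : (1 < k)%N by near: k; exact: nbhs_infty_gt.
have N0 : 0 <= Nminus g k.
  by rewrite /Nminus !mulr_ge0 ?powR_ge0 // ltW // g_gt0 // ltnW.
apply/andP; split; first by rewrite /prob_mono_AP /uniform_prob_of divr_ge0.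
apply: le_trans (prob_mono_AP_le _ _ _ _ _) _ => //.
rewrite Nminus_sqr -expr2 mulrAC divff ?mul1r // mulf_neq0 ?expf_neq0 ?pnatr_eq0 //.
by rewrite -lt0n ltnW.
Unshelve. all: by end_near.
Qed.
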